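(* For every integer $k\ge 3$ there exist real constants $A_k,B_k,C_k,D_k,E_k,F_k,G_k$ such that the polynomial identity $$P_k(x)=A_k\left[(x^2+B_kx+C_k)\,P^{(1)}_{k-2}(x)+(D_kx^3+E_kx^2+F_kx+G_k)\,P^{(1)}_{k-3}(x)\right]$$ holds.
   Context: Let $(c_i)_{i\ge 0}$ be a sequence of real numbers and let $c$ be the linear functional on the space of real polynomials in one variable defined by $c(x^i)=c_i$ for $i\ge 0$. (In the application to the Lanczos method for $A\mathbf{x}=\mathbf{b}$ one has $c_i=(\mathbf{y},A^i\mathbf{r}_0)$.) Let $c^{(1)}$ be the linear functional defined by $c^{(1)}(x^i)=c(x^{i+1})=c_{i+1}$. Standing assumptions: for every $n\ge 1$ the Hankel determinant $H^{(1)}_n=\det(c_{i+j+1})_{0\le i,j\le n-1}$ is nonzero. Consequently, for every $n\ge 0$ there is a unique polynomial $P_n$ of degree at most $n$ with $P_n(0)=1$ and $c(x^iP_n)=0$ for $0\le i\le n-1$, and a unique monic polynomial $P^{(1)}_n$ of degree $n$ with $c^{(1)}(x^iP^{(1)}_n)=0$ for $0\le i\le n-1$ (so $P_0=P_0^{(1)}=1$). Moreover $\{P_n\}$ is an orthogonal polynomial sequence with respect to $c$, meaning that for every $n\ge 0$ the polynomial $P_n$ has degree exactly $n$ and $c(x^nP_n)\ne 0$. *)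

(* Defs.v *)
From HB Require Import structures.
From mathcomp Require Import all_boot all_order all_algebra.
From mathcomp Require Import reals.

Set Implicit Arguments.
Unset Strict Implicit.
Unset Printing Implicit Defensive.
Import Order.TTheory GRing.Theory Num.Theory.
Local Open Scope ring_scope.

Section MomentFunctional.
Variable R : realType.
Implicit Types (c : nat -> R) (p : {poly R}).

Definition moment_fun c p : R := \sum_(i < size p) p`_i * c i.

Lemma moment_funE c n p : (size p <= n)%N ->
  moment_fun c p = \sum_(i < n) p`_i * c i.
Proof.
move=> le_pn; rewrite /moment_fun (big_ord_widen n (fun i => p`_i * c i) le_pn).
rewrite big_mkcond; apply: eq_bigr => i _; case: ltnP => // le_pi.
by rewrite nth_default // mul0r.
Qed.

Lemma moment_fun_linear c : scalar (moment_fun c).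
Proof.
move=> a p q; pose n := maxn (size (a *: p + q)) (maxn (size p) (size q)).
rewrite !(@moment_funE c n) ?leq_max ?leqnn ?orbT //.
rewrite mulr_sumr -big_split; apply: eq_bigr => i _ /=.
by rewrite coefD coefZ mulrDl mulrA.
Qed.

HB.instance Definition _ c :=
  GRing.isLinear.Build R {poly R} R _ (moment_fun c) (moment_fun_linear c).

(* [moment_fun c] is thus the unique linear functional taking 'X^i to c i. *)
Lemma moment_funXn c n : moment_fun c 'X^n = c n.
Proof.
rewrite /moment_fun size_polyXn big_ord_recr /= coefXn eqxx mul1r.
by rewrite big1 ?add0r // => i _; rewrite coefXn ltn_eqF // mul0r.
Qed.

Definition moment_fun1 c p : R := moment_fun (fun i => c i.+1) p.

Lemma moment_fun1Xn c n : moment_fun1 c 'X^n = moment_fun c 'X^(n.+1).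
Proof. by rewrite /moment_fun1 !moment_funXn. Qed.

Definition hankel1 c n : R := \det (\matrix_(i < n, j < n) c (i + j + 1)%N).

(* P is the polynomial P_n. *)
Definition is_lanczos_poly c n (P : {poly R}) : Prop :=
  [/\ (size P <= n.+1)%N, P.[0] = 1 &
      forall i, (i < n)%N -> moment_fun c ('X^i * P) = 0].

(* Q is the polynomial P^(1)_n. *)
Definition is_monic_orthogonal1 c n (Q : {poly R}) : Prop :=
  [/\ Q \is monic, size Q = n.+1 &
      forall i, (i < n)%N -> moment_fun1 c ('X^i * Q) = 0].

(* The orthogonality relations c(x^i P_n) = 0 for i < n are already part of
   [is_lanczos_poly]; these are the remaining nondegeneracy conditions. *)
Definition nondegenerate_OPS c (P : nat -> {poly R}) : Prop :=
  forall n, size (P n) = n.+1 /\ moment_fun c ('X^n * P n) != 0.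

End MomentFunctional.

(* Main.v *)
(* Since c(x^i P_k) = 0 for i < k, the polynomial P_k is orthogonal for c^(1)
   to x^i for i < k - 1, hence P_k = a P^(1)_k + b P^(1)_(k-1) with a its leading
   coefficient. Two applications of the three-term recurrence of the P^(1)_n
   rewrite this in terms of P^(1)_(k-2) and P^(1)_(k-3), even with D = E = 0;
   dividing by a is possible because P_k has degree exactly k. *)

Require Import Defs.
From HB Require Import structures.
From mathcomp Require Import all_boot all_order all_algebra.
From mathcomp Require Import reals ring.

Set Implicit Arguments.
Unset Strict Implicit.
Unset Printing Implicit Defensive.
Import Order.TTheory GRing.Theory Num.Theory.
Local Open Scope ring_scope.

Lemma moment_fun1_mulX (R : realType) (c : nat -> R) (p : {poly R}) :
  moment_fun1 c p = moment_fun c ('X * p).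
Proof.
have size_Xp : (size ('X * p)%R <= (size p).+1)%N.
  by rewrite mulrC; have [->|/size_mulX ->] := eqVneq p 0; rewrite ?mul0r ?size_poly0.
rewrite (moment_funE c size_Xp) big_ord_recl coefXM mul0r add0r.
by apply: eq_bigr => i _; rewrite coefXM.
Qed.

(** Any bound [n] on the size is allowed, so that the sum is row [i] of the Hankel matrix of order
    [n] times the zero-padded coefficient vector of [p]. *)
Lemma moment_fun1_Xn_mul (R : realType) (c : nat -> R) (n i : nat)
    (p : {poly R}) : (size p <= n)%N ->
  moment_fun1 c ('X^i * p) = \sum_(j < n) p`_j * c (i + j + 1)%N.
Proof.
move=> size_p; rewrite /moment_fun1.
rewrite {1}(_ : p = \sum_(j < n) p`_j *: 'X^j); last first.
  rewrite -poly_def; apply/polyP => j; rewrite coef_poly; case: ltnP => // le_nj.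
  by rewrite nth_default // (leq_trans size_p).
rewrite mulr_sumr linear_sum; apply: eq_bigr => j _ /=.
by rewrite -scalerAr -exprD linearZ /= moment_funXn addn1.
Qed.

(** The orthogonality relations form a homogeneous linear system in the coefficients of [p], whose
    matrix is the invertible Hankel matrix. *)
Lemma hankel1_orthogonal_eq0 (R : realType) (c : nat -> R) (n : nat)
    (p : {poly R}) : hankel1 c n != 0 -> (size p <= n)%N ->
  (forall i, (i < n)%N -> moment_fun1 c ('X^i * p) = 0) -> p = 0.
Proof.
move=> detH size_p orth_p.
pose H := \matrix_(i < n, j < n) c (i + j + 1)%N.
pose v : 'cV[R]_n := \col_j p`_j.
have Hv0 : H *m v = 0.
  apply/matrixP => i j; rewrite !mxE -[RHS](orth_p i) // (moment_fun1_Xn_mul _ _ size_p).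
  by apply: eq_bigr => l _; rewrite !mxE mulrC.
have unitH : H \in unitmx by rewrite unitmxE unitfE.
have v0 : v = 0 by rewrite -(mulKmx unitH v) Hv0 mulmx0.
apply/polyP => j; rewrite coef0; case: (ltnP j n) => [lt_jn | le_nj].
  by have /matrixP/(_ (Ordinal lt_jn) 0) := v0; rewrite !mxE.
by rewrite nth_default // (leq_trans size_p).
Qed.

Lemma size_sub_lead_monic (R : nzRingType) (n : nat) (p q : {poly R}) :
  (size p <= n.+1)%N -> q \is monic -> size q = n.+1 ->
  (size (p - p`_n *: q)%R <= n)%N.
Proof.
move=> size_p monic_q size_q; apply/leq_sizeP => j; rewrite leq_eqVlt.
have qn : q`_n = 1 by move/monicP: monic_q; rewrite lead_coefE size_q.
case/orP => [/eqP <- | lt_nj]; first by rewrite coefB coefZ qn mulr1 subrr.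
rewrite coefB coefZ (nth_default _ (leq_trans size_p lt_nj)).
by rewrite (@nth_default _ _ q) ?size_q // mulr0 subr0.
Qed.

Lemma orthogonal1_decomp (R : realType) (c : nat -> R) (Q : nat -> {poly R})
    (n : nat) (p : {poly R}) : hankel1 c n != 0 ->
  (forall m, is_monic_orthogonal1 c m (Q m)) -> (size p <= n.+2)%N ->
  (forall i, (i < n)%N -> moment_fun1 c ('X^i * p) = 0) ->
  exists b, p = p`_n.+1 *: Q n.+1 + b *: Q n.
Proof.
move=> detH Q_def size_p orth_p.
have [monicS sizeS orthS] := Q_def n.+1; have [monicn sizen orthn] := Q_def n.
pose r := p - p`_n.+1 *: Q n.+1; pose b := r`_n; exists b.
have size_r : (size r <= n.+1)%N by apply: size_sub_lead_monic.
have size_rb : (size (r - b *: Q n)%R <= n)%N by apply: size_sub_lead_monic.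
suff /eqP : r - b *: Q n = 0 by rewrite subr_eq0 => /eqP <-; rewrite addrC subrK.
apply: (hankel1_orthogonal_eq0 detH size_rb) => i lt_in.
have := orth_p i lt_in; have := orthn i lt_in; have := orthS i (ltnW lt_in).
rewrite /moment_fun1 !mulrBr -!scalerAr !linearB !linearZ /= => -> -> ->.
by rewrite !mulr0 !subr0.
Qed.

(** The leading terms of [Q n.+2] and ['X * Q n.+1] cancel. The factor x shifts the test power x^i
    to x^(i+1), so the difference is orthogonal to x^i for i < n and decomposes along [Q n.+1] and
    [Q n]. *)
Lemma monic_orthogonal1_three_term (R : realType) (c : nat -> R)
    (Q : nat -> {poly R}) (n : nat) : hankel1 c n != 0 ->
  (forall m, is_monic_orthogonal1 c m (Q m)) ->
  exists a b, Q n.+2 = ('X + a%:P) * Q n.+1 + b *: Q n.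
Proof.
move=> detH Q_def.
have [monicSS sizeSS orthSS] := Q_def n.+2; have [monicS sizeS orthS] := Q_def n.+1.
have XQ_monic : 'X * Q n.+1 \is monic by rewrite monicMl ?monicX.
have size_XQ : size ('X * Q n.+1) = n.+3.
  by rewrite mulrC size_mulX ?sizeS // monic_neq0.
pose p := Q n.+2 - 'X * Q n.+1.
have size_p : (size p <= n.+2)%N.
  have /(size_sub_lead_monic (n := n.+2)) : (size (Q n.+2) <= n.+3)%N by rewrite sizeSS.
  move=> /(_ _ XQ_monic size_XQ); suff -> : (Q n.+2)`_n.+2 = 1 by rewrite scale1r.
  by move/monicP: monicSS; rewrite lead_coefE sizeSS.
have orth_p i : (i < n)%N -> moment_fun1 c ('X^i * p) = 0.
  move=> lt_in; have := orthS i.+1 lt_in; have := orthSS i (leqW (leqW lt_in)).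
  by rewrite /moment_fun1 /p mulrBr mulrA -exprSr linearB /= => -> ->; rewrite subr0.
have [b p_eq] := orthogonal1_decomp detH Q_def size_p orth_p.
exists p`_n.+1, b.
by rewrite mulrDl mul_polyC -addrA -p_eq /p addrC subrK.
Qed.

Theorem proposition3p3 (R : realType) (c : nat -> R)
  (P P1 : nat -> {poly R})
  (hankel_neq0 : forall n : nat, (1 <= n)%N -> hankel1 c n != 0)
  (P_def : forall n : nat, is_lanczos_poly c n (P n))
  (P1_def : forall n : nat, is_monic_orthogonal1 c n (P1 n))
  (P_OPS : nondegenerate_OPS c P) :
  forall k : nat, (3 <= k)%N ->
  exists A B C D E F G : R,
    P k = A *: (('X^2 + B *: 'X + C%:P) * P1 (k - 2)%N
              + (D *: 'X^3 + E *: 'X^2 + F *: 'X + G%:P) * P1 (k - 3)%N).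
Proof.
case=> [//|[//|[//|k]]] _.
have detH n : hankel1 c n != 0.
  (* The empty determinant is 1; order 0 occurs in the recurrence for [Q2] when [k] is 0. *)
  by case: n => [|n]; [rewrite /hankel1 det_mx00 oner_neq0 | exact: hankel_neq0].
have -> : (k.+3 - 2 = k.+1)%N by rewrite !subSS subn0.
have -> : (k.+3 - 3 = k)%N by rewrite !subSS subn0.
have [size_le _ orth_P] := P_def k.+3; have [size_P _] := P_OPS k.+3.
(* Passing from c to c^(1) uses up one power of x, hence one relation fewer. *)
have orth1_P i : (i < k.+2)%N -> moment_fun1 c ('X^i * P k.+3) = 0.
  by move=> lt_ik; rewrite moment_fun1_mulX mulrA -exprS orth_P.
have [b P_eq] := orthogonal1_decomp (detH _) P1_def size_le orth1_P.
have lead_neq0 : (P k.+3)`_k.+3 != 0.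
  by have := lead_coef_eq0 (P k.+3); rewrite lead_coefE size_P -size_poly_eq0 size_P => ->.
have [a1 [b1 Q3]] := monic_orthogonal1_three_term (detH k.+1) P1_def.
have [a0 [b0 Q2]] := monic_orthogonal1_three_term (detH k) P1_def.
move: P_eq lead_neq0; set A := (P k.+3)`_k.+3 => P_eq A_neq0.
have [e P_eqA] : exists e, P k.+3 = A *: (('X + e%:P) * P1 k.+2 + b1 *: P1 k.+1).
  (* After [Q3] is inserted, the term b P^(1)_(k+2) is absorbed into the linear factor, at the cost
     of dividing by [A]. *)
  exists (a1 + b / A); rewrite P_eq Q3 polyCD mulrDl mulrDl mulrDl mul_polyC !mul_polyC !scalerDr.
  by rewrite !scalerA (mulrC A (b / A)) divfK // -!addrA; congr (_ + (_ + _)); rewrite addrC.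
(* These are the coefficients of (x + e)(x + a0) + b1 and of b0 (x + e), obtained by inserting
   [Q2]. *)
exists A, (a0 + e), (e * a0 + b1), 0, 0, b0, (e * b0).
by rewrite P_eqA Q2 -!mul_polyC !polyCD !polyCM; ring.
Qed.
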